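(* Let $S\in Sp(2g,\mathbb{Z})$ be a symplectic involution, i.e. $S^{T}JS=J$ and $S^2=\mathrm{Id}$, acting on $W=\mathbb{Z}^{2g}$ equipped with the canonical pairing $\langle\cdot,\cdot\rangle$. Then there exist submodules $L_1,L_2$ of $W$ such that $W=L_1\oplus L_2$, with $\langle L_i,L_i\rangle=0$ and $SL_i=L_i$ for $i=1,2$ (that is, $W$ is the direct sum of two $S$-stable Lagrangian submodules).
   Context: $1_g$ denotes the $g\times g$ identity matrix, $J=\begin{pmatrix}0&1_g\\-1_g&0\end{pmatrix}$, and $Sp(2g,\mathbb{Z})=\{\gamma\in GL(2g,\mathbb{Z})\mid \gamma^{T}J\gamma=J\}$. The canonical pairing on $\mathbb{Z}^{2g}$ is $\langle x,y\rangle=x^{T}Jy$, and $\langle L_i,L_i\rangle=0$ means $\langle x,y\rangle=0$ for all $x,y\in L_i$. *)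

(* Defs.v *)
From HB Require Import structures.
From mathcomp Require Import all_boot all_order all_algebra.

Set Implicit Arguments.
Unset Strict Implicit.
Unset Printing Implicit Defensive.

Import GRing.Theory.
Local Open Scope ring_scope.

Definition Jmx (g : nat) : 'M[int]_(g + g) :=
  block_mx 0 1%:M (- 1%:M) 0.

(* Membership of GL(2g, Z) is invertibility over int, i.e. unitmx. *)
Definition Sp (g : nat) : {pred 'M[int]_(g + g)} :=
  [pred A | (A \in unitmx) && (A^T *m Jmx g *m A == Jmx g)].

Arguments Sp : clear implicits.

Definition pairing (g : nat) (x y : 'cV[int]_(g + g)) : int :=
  (x^T *m Jmx g *m y) ord0 ord0.

(* A submodule of Z^n has decidable membership (it is finitely generated), so
   boolean predicates satisfying GRing.submod_closed cover all submodules. *)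
Definition isotropic (g : nat) (L : {pred 'cV[int]_(g + g)}) : Prop :=
  forall x y, x \in L -> y \in L -> pairing x y = 0.

Definition is_direct_sum (V : zmodType) (L1 L2 : {pred V}) : Prop :=
  (forall w : V, exists x y : V, [/\ x \in L1, y \in L2 & w = x + y])
  /\ (forall w : V, w \in L1 -> w \in L2 -> w = 0).

(* S L = L, as equality of the image with L. *)
Definition mx_image_eq (n : nat) (S : 'M[int]_n) (L : {pred 'cV[int]_n}) :
    Prop :=
  forall w : 'cV[int]_n, w \in L <-> exists2 v, v \in L & w = S *m v.

(* Main.v *)
Require Import Defs.
From HB Require Import structures.
From mathcomp Require Import all_boot all_order all_algebra.
From mathcomp Require Import zify ring.

Set Implicit Arguments.
Unset Strict Implicit.
Unset Printing Implicit Defensive.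

Import GRing.Theory.
Local Open Scope ring_scope.

(** Regard W as a lattice over R = Z[C_2], the generator acting by S.  As S
is an isometry and an involution, <Sx, y> = <x, Sy>, hence
h(x, y) = <x, y> + <x, Sy> S is an alternating R-bilinear form on W; in
particular <x, Sx> = 0 for all x, so every cyclic submodule Rx is isotropic.
The idea is to split off orthogonal S-stable summands Rx + Ry with Rx and Ry
in duality, and to collect the Rx in one Lagrangian and the Ry in the other.

Submodules are handled through their projections.  An S-stable unimodular
orthogonal summand is an idempotent F that is self-adjoint and commutes with
S (orthoproj); a decomposition of its image into two S-stable Lagrangians is
F = E + E', where E is an idempotent commuting with S, E' is its adjoint and
E E' = E' E = 0 (splitting).  Splittings of orthogonal summands add up
(splittingD), so induction on the rank of F reduces the theorem to finding one
nonzero summand with a splitting inside F (splitting_summand).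

That summand comes from a dual pair, according to the parity of (1 + S)F.

If (1 + S)F = 2K, then K is the projection on the part of the image of F fixed
by S.  When K = 0, S acts on the image of F by -1.  So K or F projects on a
nonzero orthogonal summand where S is a sign; a primitive vector x in it has a y
in it with <x, y> = 1, and the span of x and y is the summand (splitting_eigen).

Otherwise some w in the image of F has w + Sw not divisible by 2, so
w + Sw = d e with d odd and e primitive.  Subtracting multiples of eigenvectors
from w turns it into an x such that x + Sx and x - Sx are both primitive.  Then
x and Sx span a free R-summand, and x has a partner y with <x, y> = 1 and
<x, Sy> = 0, that is, h(x, y) = 1 (regular_pair). *)

(** * Integer matrices *)

Lemma eq_mx_cV m n (A B : 'M[int]_(m, n)) :
  (forall w : 'cV_n, A *m w = B *m w) -> A = B.
Proof.
move=> eqAB; apply/matrixP=> i j; have := eqAB (delta_mx j 0).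
by rewrite -!colE => /colP/(_ i); rewrite !mxE.
Qed.

Lemma scalemx_inj m n (a : int) : a != 0 ->
  injective ( *:%R a : 'M[int]_(m, n) -> 'M[int]_(m, n)).
Proof.
move=> a_neq0 A B eqAB; apply/matrixP=> i j; apply: (mulfI a_neq0).
by have /matrixP/(_ i j) := eqAB; rewrite !mxE.
Qed.

Lemma even_or_odd_int (d : int) :
  (exists k, d = 2 * k) \/ (exists k, d = 2 * k + 1).
Proof.
have /orP[/eqP d0|/eqP d1] : ((d %% 2)%Z == 0) || ((d %% 2)%Z == 1) by lia.
  by left; exists (d %/ 2)%Z; lia.
by right; exists (d %/ 2)%Z; lia.
Qed.

Lemma even_mx_or_col m n (A : 'M[int]_(m, n)) :
  (exists K, A = 2 *: K) \/
  (exists w : 'cV[int]_n, forall u, A *m w <> 2 *: u).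
Proof.
have [/forallP evenA | /forallPn[j /forallPn[i oddA]]] :=
  boolP [forall j, forall i, (2 %| A i j)%Z].
  left; exists (\matrix_(i, j) (A i j %/ 2)%Z); apply/matrixP=> i j.
  by rewrite !mxE mulrC divzK ?(forallP (evenA j)).
right; exists (delta_mx j 0) => u; rewrite -colE => /matrixP/(_ i 0).
by rewrite !mxE => eqA; rewrite eqA dvdz_mulr in oddA.
Qed.

(** The Smith normal form L D R of a column v has a single possibly nonzero
entry in D, so v is a multiple of the first column of L, and the first row of
L^-1 witnesses that this column is primitive. *)
Lemma primitive_part n (v : 'cV[int]_n) : v != 0 ->
  exists d (e : 'cV[int]_n) (u : 'rV[int]_n), v = d *: e /\ u *m e = 1%:M.
Proof.
case: n v => [|n] v; first by rewrite flatmx0 eqxx.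
have [L Lu [R _ [s _ ->]]] := int_Smith_normal_form v => _.
exists (s`_0 * R 0 0), (col 0 L), (row 0 (invmx L)); split; last first.
  rewrite rowE colE mulmxA -[_ *m _ *m L]mulmxA mulVmx // mulmx1 mul_delta_mx.
  by apply/matrixP=> i j; rewrite !mxE !ord1.
have -> : \matrix_(i < n.+1, j < 1) (s`_i *+ (i == j :> nat))
   = s`_0 *: delta_mx 0 0.
  apply/matrixP=> i j; rewrite !mxE ord1 /= andbT -val_eqE /=.
  by case: (nat_of_ord i) => [|k]; rewrite ?mulr1 ?mulr0 ?mulr0n.
rewrite colE [R in LHS]mx11_scalar mul_mx_scalar -scalemxAr scalerA mulrC.
by [].
Qed.

(** * The alternating form and adjoints *)

Section SymplecticInvolution.

Variables (n : nat) (G S : 'M[int]_n).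
Hypotheses (G_skew : G^T = - G) (G_unit : G \in unitmx).
Hypotheses (S_adj : S^T *m G = G *m S) (S_inv : S *m S = 1%:M).

Implicit Types (x y w : 'cV[int]_n) (A B E F : 'M[int]_n).

Definition form x y : int := (x^T *m G *m y) 0 0.

Lemma form_mx x y : x^T *m G *m y = (form x y)%:M.
Proof. exact: mx11_scalar. Qed.

Lemma formDl x1 x2 y : form (x1 + x2) y = form x1 y + form x2 y.
Proof. by rewrite /form linearD /= !mulmxDl mxE. Qed.

Lemma formDr x y1 y2 : form x (y1 + y2) = form x y1 + form x y2.
Proof. by rewrite /form !mulmxDr mxE. Qed.

Lemma formZl a x y : form (a *: x) y = a * form x y.
Proof. by rewrite /form linearZ /= -!scalemxAl mxE. Qed.

Lemma formZr a x y : form x (a *: y) = a * form x y.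
Proof. by rewrite /form -!scalemxAr mxE. Qed.

Lemma formC x y : form x y = - form y x.
Proof.
rewrite /form -[in LHS](trmxK y) -[x^T *m G]trmxK -trmx_mul mxE.
by rewrite trmx_mul trmxK G_skew mulNmx mulmxN mulmxA mxE.
Qed.

Lemma form_alt x : form x x = 0.
Proof. have := formC x x; lia. Qed.

Definition adjoint A B := A^T *m G = G *m B.

Lemma adjointP A B x y : adjoint A B -> form (A *m x) y = form x (B *m y).
Proof.
by move=> adjAB; rewrite /form trmx_mul -(mulmxA x^T A^T) adjAB !mulmxA.
Qed.

Lemma adjoint_sym A B : adjoint A B -> adjoint B A.
Proof.
rewrite /adjoint => adjAB.
have /(congr1 -%R) := congr1 trmx adjAB.
by rewrite !trmx_mul trmxK G_skew mulNmx mulmxN !opprK.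
Qed.

Lemma adjointM A A' B B' :
  adjoint A A' -> adjoint B B' -> adjoint (A *m B) (B' *m A').
Proof.
by rewrite /adjoint => adjA adjB; rewrite trmx_mul -mulmxA adjA !mulmxA adjB.
Qed.

Lemma adjointD A A' B B' :
  adjoint A A' -> adjoint B B' -> adjoint (A + B) (A' + B').
Proof.
by rewrite /adjoint => adjA adjB; rewrite linearD mulmxDl adjA adjB mulmxDr.
Qed.

Lemma adjointN A A' : adjoint A A' -> adjoint (- A) (- A').
Proof. by rewrite /adjoint => adjA; rewrite linearN mulNmx adjA mulmxN. Qed.

Lemma adjoint_uniq A B B' : adjoint A B -> adjoint A B' -> B = B'.
Proof.
by rewrite /adjoint => -> /(congr1 (mulmx (invmx G))); rewrite !mulKmx.
Qed.

Lemma form_S x y : form (S *m x) y = form x (S *m y).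
Proof. exact: adjointP. Qed.

Lemma S_K w : S *m (S *m w) = w.
Proof. by rewrite mulmxA S_inv mul1mx. Qed.

(** The form <x, Sy> is again skew-symmetric, S being self-adjoint. *)
Lemma form_xSx x : form x (S *m x) = 0.
Proof. have := formC x (S *m x); rewrite form_S; lia. Qed.

Lemma form_SS x y : form (S *m x) (S *m y) = form x y.
Proof. by rewrite form_S S_K. Qed.

(** * Orthogonal projections and their Lagrangian splittings *)

(** Self-adjointness makes the kernel the orthogonal of the image, so the image
is a unimodular S-stable summand. *)
Definition orthoproj F := [/\ F *m F = F, S *m F = F *m S & adjoint F F].

(** The images of E and E' are S-stable, and the orthogonality relations say
that both are isotropic: <Ex, Ey> = <x, E'Ey>. *)
Definition splitting F E E' :=
  [/\ F = E + E', E *m E = E, E *m E' = 0 & E' *m E = 0]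
  /\ S *m E = E *m S /\ adjoint E E'.

Lemma splitting_idem' F E E' : splitting F E E' -> E' *m E' = E'.
Proof.
move=> [[_ EE _ _] [_ adjE]]; apply: (adjoint_uniq (A := E)) => //.
by rewrite -[X in adjoint X]EE; apply: adjointM.
Qed.

Lemma splitting_comm' F E E' : splitting F E E' -> S *m E' = E' *m S.
Proof.
move=> [_ [SE adjE]]; apply: (adjoint_uniq (A := E *m S)).
  exact: adjointM.
by rewrite -SE; apply: adjointM.
Qed.

Lemma splitting_orthoproj F E E' : splitting F E E' -> orthoproj F.
Proof.
move=> splitF; have E'E' := splitting_idem' splitF.
have SE' := splitting_comm' splitF.
case: splitF => [[-> EE EE' E'E] [SE adjE]]; split.
- by rewrite mulmxDl !mulmxDr EE EE' E'E E'E' addr0 add0r.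
- by rewrite mulmxDl mulmxDr SE SE'.
- by rewrite {2}addrC; apply: adjointD => //; apply: adjoint_sym.
Qed.

Lemma splitting_absorb F E E' : splitting F E E' ->
  [/\ F *m E = E, E *m F = E, F *m E' = E' & E' *m F = E'].
Proof.
move=> splitF; have E'E' := splitting_idem' splitF.
case: splitF => [[-> EE EE' E'E] _].
by rewrite !mulmxDl !mulmxDr EE EE' E'E E'E' !addr0 !add0r.
Qed.

(** A summand of the splitting of F1 is fixed by F1 on both sides, so all the
mixed products factor through F1 F2 or F2 F1. *)
Lemma splittingD F1 E1 E1' F2 E2 E2' :
    F1 *m F2 = 0 -> F2 *m F1 = 0 ->
    splitting F1 E1 E1' -> splitting F2 E2 E2' ->
  splitting (F1 + F2) (E1 + E2) (E1' + E2').
Proof.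
move=> F12 F21 split1 split2.
have [l1 r1 l1' r1'] := splitting_absorb split1.
have [l2 r2 l2' r2'] := splitting_absorb split2.
have kill F A B F' : A *m F = A -> F' *m B = B -> F *m F' = 0 -> A *m B = 0.
  by move=> <- <- FF'; rewrite mulmxA -(mulmxA A) FF' mulmx0 mul0mx.
case: split1 => [[-> EE1 EE1' E'E1] [SE1 adj1]].
case: split2 => [[-> EE2 EE2' E'E2] [SE2 adj2]].
split; [split | split].
- by rewrite addrACA.
- rewrite mulmxDl !mulmxDr EE1 EE2 (kill _ _ _ _ r1 l2 F12).
  by rewrite (kill _ _ _ _ r2 l1 F21) addr0 add0r.
- rewrite mulmxDl !mulmxDr EE1' EE2' (kill _ _ _ _ r1 l2' F12).
  by rewrite (kill _ _ _ _ r2 l1' F21) !addr0.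
- rewrite mulmxDl !mulmxDr E'E1 E'E2 (kill _ _ _ _ r1' l2 F12).
  by rewrite (kill _ _ _ _ r2' l1 F21) !addr0.
- by rewrite mulmxDl mulmxDr SE1 SE2.
- exact: adjointD.
Qed.

(** * Splittings from dual pairs *)

Definition dyad x y : 'M[int]_n := - (x *m y^T *m G).

Lemma dyadE x y w : dyad x y *m w = form w y *: x.
Proof.
rewrite /dyad mulNmx -!mulmxA (mulmxA y^T) form_mx mul_mx_scalar formC.
by rewrite scaleNr opprK.
Qed.

Lemma adjoint_dyad x y : adjoint (dyad x y) (- dyad y x).
Proof.
rewrite /adjoint /dyad opprK linearN /= !trmx_mul trmxK G_skew !mulNmx.
by rewrite opprK !mulmxA.
Qed.

Lemma mul_dyad F x y : F *m dyad x y = dyad (F *m x) y.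
Proof. by apply: eq_mx_cV => w; rewrite -mulmxA !dyadE scalemxAr. Qed.

Lemma dyad_mul F F' x y : adjoint F F' -> dyad x y *m F = dyad x (F' *m y).
Proof.
move=> adjF; apply: eq_mx_cV => w.
by rewrite -mulmxA !dyadE (adjointP _ _ adjF).
Qed.

(** For x and y dual in the same eigenlattice of S, the operators w |-> <w, y> x
and w |-> <x, w> y are adjoint projections on the lines of x and y. *)
Lemma splitting_dyad x y e : e * e = 1 ->
    form x y = 1 -> S *m x = e *: x -> S *m y = e *: y ->
  splitting (dyad x y - dyad y x) (dyad x y) (- dyad y x).
Proof.
move=> ee xy Sx Sy; split; [split | split] => //.
- by rewrite mul_dyad dyadE xy scale1r.
- by rewrite mulmxN mul_dyad dyadE form_alt scale0r /dyad !mul0mx !oppr0.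
- by rewrite mulNmx mul_dyad dyadE form_alt scale0r /dyad !mul0mx !oppr0.
- rewrite mul_dyad (dyad_mul _ _ S_adj) Sx Sy /dyad linearZ /=.
  by rewrite -scalemxAl -scalemxAr.
- exact: adjoint_dyad.
Qed.

(** With h(x, y) = <x, y> + <x, Sy> S this is w |-> h(w, y) x, the rank one
operator of the Z[C_2]-valued form. *)
Definition dyadS x y : 'M[int]_n := dyad x y + dyad (S *m x) (S *m y).

Lemma dyadSE x y w :
  dyadS x y *m w = form w y *: x + form w (S *m y) *: (S *m x).
Proof. by rewrite mulmxDl !dyadE. Qed.

Lemma mul_dyadS F x y : S *m F = F *m S ->
  F *m dyadS x y = dyadS (F *m x) y.
Proof. by move=> SF; rewrite /dyadS mulmxDr !mul_dyad !mulmxA SF. Qed.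

Lemma dyadS_mul F x y : S *m F = F *m S -> adjoint F F ->
  dyadS x y *m F = dyadS x (F *m y).
Proof.
by move=> SF adjF; rewrite /dyadS mulmxDl !(dyad_mul _ _ adjF) !mulmxA SF.
Qed.

Lemma mul_dyadS0 x y z t : form x t = 0 -> form x (S *m t) = 0 ->
  dyadS z t *m dyadS x y = 0.
Proof.
move=> xt xSt; apply: eq_mx_cV => w; rewrite -mulmxA mul0mx !dyadSE.
rewrite !formDl !formZl !form_SS !form_S xt xSt.
by rewrite !mulr0 !addr0 !scale0r addr0.
Qed.

(** The hypotheses say h(x, y) = 1, so this is the same computation as for a
dual pair of eigenvectors, with h in place of the form. *)
Lemma splitting_dyadS x y : form x y = 1 -> form x (S *m y) = 0 ->
  splitting (dyadS x y - dyadS y x) (dyadS x y) (- dyadS y x).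
Proof.
move=> xy xSy; split; [split | split] => //.
- apply: eq_mx_cV => w; rewrite -mulmxA !dyadSE !formDl !formZl !form_SS.
  by rewrite !form_S xy xSy !mulr1 !mulr0 addr0 add0r.
- by rewrite mulmxN mul_dyadS0 ?form_alt ?form_xSx ?oppr0.
- by rewrite mulNmx mul_dyadS0 ?form_alt ?form_xSx ?oppr0.
- rewrite mul_dyadS // dyadS_mul // /dyadS !S_K; exact: addrC.
- by rewrite /dyadS opprD; apply: adjointD; apply: adjoint_dyad.
Qed.

(** * Existence of dual pairs *)

(** Unimodularity of G turns the functional that detects primitivity of x into
a vector y; projecting y into the image of F keeps the pairing with x, since F
is self-adjoint and fixes x. *)
Lemma primitive_dual F w : F *m F = F -> adjoint F F ->
    F *m w = w -> w != 0 ->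
  exists d x y,
    [/\ w = d *: x, d != 0, F *m x = x, F *m y = y & form x y = 1].
Proof.
move=> FF adjF Fw w_neq0.
have [d [x [u [wE ux]]]] := primitive_part w_neq0.
have d_neq0 : d != 0 by apply: contraNneq w_neq0 => d0; rewrite wE d0 scale0r.
have Fx : F *m x = x.
  by apply: (scalemx_inj d_neq0); rewrite /= scalemxAr -wE.
exists d, x, (F *m (invmx G *m u^T)); split => //.
  by rewrite mulmxA FF.
rewrite -(adjointP _ _ adjF) Fx /form -mulmxA mulKVmx // -trmx_mul ux.
by rewrite trmx1 mxE.
Qed.

Lemma nonzero_image F : F *m F = F -> F != 0 ->
  exists2 w : 'cV[int]_n, F *m w = w & w != 0.
Proof.
move=> FF F_neq0.
have [j Fj | F0] := pickP (fun j => col j F != 0).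
  by exists (col j F); rewrite // colE mulmxA FF.
case/eqP: F_neq0; apply/matrixP=> i j.
by have /negbFE/eqP/colP/(_ i) := F0 j; rewrite !mxE.
Qed.

Lemma splitting_eigen F e : e * e = 1 -> orthoproj F -> S *m F = e *: F ->
    F != 0 ->
  exists x y, [/\ splitting (dyad x y - dyad y x) (dyad x y) (- dyad y x),
    form x y = 1, F *m x = x & F *m y = y].
Proof.
move=> ee [FF _ adjF] SF F_neq0.
have [w Fw w_neq0] := nonzero_image FF F_neq0.
have [d [x [y [_ _ Fx Fy xy]]]] := primitive_dual FF adjF Fw w_neq0.
have S_im z : F *m z = z -> S *m z = e *: z.
  by move=> Fz; rewrite -{1}Fz mulmxA SF -scalemxAl Fz.
by exists x, y; split => //; apply: (splitting_dyad ee xy); apply: S_im.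
Qed.

(** Subtracting k e from w replaces the odd multiple (2k + 1) e of e by e in
w + Sw, and subtracting l f then does the same for the difference without
changing the sum, as Sf = -f.  The partner of the resulting x is corrected from
the partner y1 of e = x + Sx: the defect b = <Sx, y1> is removed by a multiple
of z = y2 - S y2, where y2 is the partner of f = x - Sx, because <x, z> = 1 and
<x, Sz> = -1. *)
Lemma regular_pair F w : orthoproj F -> F *m w = w ->
    (forall u, w + S *m w <> 2 *: u) ->
  exists x y, [/\ F *m x = x, F *m y = y, form x y = 1 & form x (S *m y) = 0].
Proof.
move=> [FF SF adjF] Fw w_odd.
have F_S z : F *m z = z -> F *m (S *m z) = S *m z.
  by move=> Fz; rewrite mulmxA -SF -mulmxA Fz.
have [||d [e [y1 [wE d_neq0 Fe Fy1 ey1]]]] :=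
    @primitive_dual F (w + S *m w) FF adjF.
- by rewrite mulmxDr Fw F_S.
- by apply/eqP => w0; apply: (w_odd 0); rewrite w0 scaler0.
have [[k dE]|[k dE]] := even_or_odd_int d.
  by case: (w_odd (k *: e)); rewrite wE dE scalerA.
have Se : S *m e = e.
  apply: (scalemx_inj d_neq0); rewrite /= scalemxAr -wE mulmxDr S_K.
  exact: addrC.
pose c := w - k *: e.
have Fc : F *m c = c by rewrite mulmxBr -scalemxAr Fw Fe.
have cSc : c + S *m c = e.
  rewrite /c mulmxBr -scalemxAr Se addrACA -opprD wE dE -scalerDl -scalerBl.
  by rewrite (_ : _ - _ = 1) ?scale1r //; ring.
(* c - Sc and c + Sc = e agree modulo 2, and e is primitive. *)
have c_odd u : c - S *m c <> 2 *: u.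
  move=> cE; have : e = 2 *: (u + S *m c).
    rewrite -cSc scalerDr -cE scaler_nat mulr2n addrA.
    by congr (_ + _); rewrite subrK.
  move/(congr1 (form^~ y1)); rewrite ey1 formZl; lia.
have [||m [f [y2 [cE m_neq0 Ff Fy2 fy2]]]] :=
    @primitive_dual F (c - S *m c) FF adjF.
- by rewrite mulmxBr Fc F_S.
- by apply/eqP => c0; apply: (c_odd 0); rewrite c0 scaler0.
have [[l mE]|[l mE]] := even_or_odd_int m.
  by case: (c_odd (l *: f)); rewrite cE mE scalerA.
have Sf : S *m f = - f.
  apply: (scalemx_inj m_neq0).
  by rewrite /= scalemxAr -cE mulmxBr S_K scalerN -cE (opprB c).
pose x := c - l *: f.
have xE : x + S *m x = e.
  by rewrite /x mulmxBr -scalemxAr Sf scalerN opprK addrACA addNr addr0.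
have xF : x - S *m x = f.
  rewrite /x mulmxBr -scalemxAr Sf scalerN opprK opprD addrACA cE mE.
  by rewrite -opprD -scalerDl -scalerBl (_ : _ - _ = 1) ?scale1r //; ring.
have Fx : F *m x = x by rewrite /x mulmxBr -scalemxAr Fc Ff.
clearbody x.
pose z := y2 - S *m y2.
have xz : form x z = 1.
  rewrite -fy2 -xF /z -!scaleN1r formDr formZr formDl formZl.
  by rewrite form_S.
have Sz : S *m z = - 1 *: z by rewrite mulmxBr S_K scaleN1r opprB.
pose b := form (S *m x) y1.
exists x, (y1 + b *: z); split => //.
- by rewrite mulmxDr -scalemxAr mulmxBr F_S // Fy1 Fy2.
- by rewrite formDr formZr xz mulr1 -formDl xE.
- rewrite mulmxDr -scalemxAr Sz formDr !formZr xz -form_S -/b; ring.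
Qed.

Lemma orthoprojB F K : orthoproj F -> orthoproj K ->
  F *m K = K -> K *m F = K -> orthoproj (F - K).
Proof.
move=> [FF SF adjF] [KK SK adjK] FK KF; split.
- by rewrite mulmxBl !mulmxBr FF FK KF KK subrr subr0.
- by rewrite mulmxBl mulmxBr SF SK.
- by apply: adjointD => //; apply: adjointN.
Qed.

(** If (1 + S)F is not divisible by 2, the image of F contains a free
Z[C_2]-summand; otherwise K = (1 + S)F / 2 is the integral projection on the
part of the image of F fixed by S, and S = -1 on the image of F if K vanishes. *)
Lemma splitting_summand F : orthoproj F -> F != 0 ->
  exists P D D', [/\ splitting P D D', P != 0, F *m P = P & P *m F = P].
Proof.
move=> orthoF F_neq0; have [FF SF adjF] := orthoF.
have dyad_case K e : e * e = 1 -> orthoproj K -> S *m K = e *: K -> K != 0 ->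
    F *m K = K ->
    exists P D D', [/\ splitting P D D', P != 0, F *m P = P & P *m F = P].
  move=> ee orthoK SK K_neq0 FK.
  have [x [y [splitP xy Kx Ky]]] := splitting_eigen ee orthoK SK K_neq0.
  have Fx : F *m x = x by rewrite -Kx mulmxA FK.
  have Fy : F *m y = y by rewrite -Ky mulmxA FK.
  exists (dyad x y - dyad y x), (dyad x y), (- dyad y x); split => //.
  - apply/eqP => P0; have : form ((dyad x y - dyad y x) *m x) y = 0.
      by rewrite P0 mul0mx -(scale0r 0) formZl mul0r.
    by rewrite mulmxBl !dyadE form_alt xy scale0r subr0 scale1r xy.
  - by rewrite mulmxBr !mul_dyad Fx Fy.
  - by rewrite mulmxBl !(dyad_mul _ _ adjF) Fx Fy.
have [[K KE] | [w w_odd]] := even_mx_or_col (F + S *m F); last first.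
  have [||x [y [Fx Fy xy xSy]]] := @regular_pair F (F *m w) orthoF.
  - by rewrite mulmxA FF.
  - by move=> u uE; apply: (w_odd u); rewrite -uE mulmxDl mulmxA.
  exists (dyadS x y - dyadS y x), (dyadS x y), (- dyadS y x); split => //.
  - exact: splitting_dyadS.
  - apply/eqP => P0; have : form ((dyadS x y - dyadS y x) *m x) y = 0.
      by rewrite P0 mul0mx -(scale0r 0) formZl mul0r.
    rewrite mulmxBl !dyadSE form_alt form_xSx xy xSy !scale0r !addr0.
    by rewrite subr0 scale1r xy.
  - by rewrite mulmxBr !mul_dyadS // Fx Fy.
  - by rewrite mulmxBl !dyadS_mul // Fx Fy.
have two_inj : injective ( *:%R 2 : 'M[int]_n -> 'M[int]_n).
  exact: scalemx_inj.
have SK : S *m K = K.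
  apply: two_inj; rewrite /= scalemxAr -KE mulmxDr mulmxA S_inv mul1mx.
  exact: addrC.
have FK : F *m K = K.
  apply: two_inj; rewrite /= scalemxAr -KE mulmxDr mulmxA -SF -mulmxA FF.
  by [].
have KF : K *m F = K.
  by apply: two_inj; rewrite /= scalemxAl -KE mulmxDl -mulmxA FF.
have KS : K *m S = K.
  apply: two_inj; rewrite /= scalemxAl -KE mulmxDl -mulmxA -SF mulmxA S_inv.
  rewrite mul1mx; exact: addrC.
have KK : K *m K = K.
  apply: two_inj; rewrite /= scalemxAl -{1}KE mulmxDl -mulmxA FK SK scaler_nat.
  by rewrite mulr2n.
have adjK : adjoint K K.
  have : adjoint (2 *: K) (2 *: K).
    by rewrite -KE; apply: adjointD => //; rewrite {2}SF; apply: adjointM.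
  rewrite /adjoint linearZ /= -scalemxAl -scalemxAr; exact: scalemx_inj.
have orthoK : orthoproj K by split; rewrite ?SK.
have [K0 | K_neq0] := eqVneq K 0; last first.
  by apply: (dyad_case K 1); rewrite ?scale1r.
(* K = 0 leaves S = -1 on the whole image of F. *)
apply: (dyad_case F (-1)) => //.
by rewrite scaleN1r; apply/eqP; rewrite -addr_eq0 addrC KE K0 scaler0.
Qed.

(** * Induction on the rank *)

Lemma rank_complement F P : F *m P = P -> P *m F = P -> P *m P = P ->
    F *m F = F -> P != 0 ->
  (\rank (map_mx intr (F - P) : 'M[rat]_n)
     < \rank (map_mx intr F : 'M[rat]_n))%N.
Proof.
move=> FP PF PP FF P_neq0; apply: rank_ltmx; rewrite ltmxE; apply/andP; split.
  have -> : F - P = (F - P) *m F by rewrite mulmxBl FF PF.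
  by rewrite map_mxM submxMl.
apply: contra P_neq0 => /submxP[X FX]; apply/eqP.
have : map_mx intr P = 0 :> 'M[rat]_n.
  by rewrite -FP map_mxM FX -mulmxA -map_mxM mulmxBl FP PP subrr map_mx0 mulmx0.
move=> /matrixP P0; apply/matrixP=> i j; have /eqP := P0 i j.
by rewrite !mxE intr_eq0 => /eqP.
Qed.

Theorem orthoproj_splits F : orthoproj F -> exists E E', splitting F E E'.
Proof.
have [r] := ubnP (\rank (map_mx intr F : 'M[rat]_n)).
elim: r F => // r IHr F; rewrite ltnS => rankF orthoF.
have [-> | F_neq0] := eqVneq F 0.
  exists 0, 0; split; first by split; rewrite ?mulmx0 ?addr0.
  by split; rewrite /adjoint ?trmx0 ?mulmx0 ?mul0mx.
have [P [D [D' [splitP P_neq0 FP PF]]]] := splitting_summand orthoF F_neq0.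
have orthoP := splitting_orthoproj splitP.
have [[FF _ _] [PP _ _]] := (orthoF, orthoP).
have [||E [E' splitE]] := IHr (F - P).
- exact: leq_trans (rank_complement FP PF PP FF P_neq0) rankF.
- exact: orthoprojB.
exists (D + E), (D' + E'); rewrite -[F](subrKC P).
apply: splittingD => //; first by rewrite mulmxBr PF PP subrr.
by rewrite mulmxBl FP PP subrr.
Qed.

End SymplecticInvolution.

(** * The standard symplectic form *)

Lemma Jmx_skew g : (Jmx g)^T = - Jmx g.
Proof.
rewrite /Jmx tr_block_mx opp_block_mx linearN /= !trmx0 !trmx1 oppr0.
by rewrite opprK.
Qed.

Lemma Jmx_unit g : Jmx g \in unitmx.
Proof.
have : Jmx g *m - Jmx g = 1%:M.
  rewrite mulmxN /Jmx mulmx_block !mulmx0 !mul0mx !mul1mx !mulmx1.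
  by rewrite !addr0 !add0r opp_block_mx !opprK !oppr0 -scalar_mx_block.
by case/mulmx1_unit.
Qed.

Definition mx_ker n (E : 'M[int]_n) : {pred 'cV[int]_n} :=
  [pred w | E *m w == 0].

Lemma mx_kerE n (E : 'M[int]_n) w : (w \in mx_ker E) = (E *m w == 0).
Proof. by []. Qed.

Lemma ker_submod n (E : 'M[int]_n) :
  GRing.submod_closed (mx_ker E).
Proof.
split=> [|a u v]; rewrite !mx_kerE ?mulmx0 // => /eqP Eu /eqP Ev.
by rewrite mulmxDr -scalemxAr Eu Ev scaler0 addr0.
Qed.

Lemma ker_image_eq n (S E : 'M[int]_n) : S *m S = 1%:M -> S *m E = E *m S ->
  mx_image_eq S (mx_ker E).
Proof.
move=> SS SE w; rewrite mx_kerE; split=> [/eqP Ew | [v]].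
  exists (S *m w); last by rewrite mulmxA SS mul1mx.
  by rewrite mx_kerE mulmxA -SE -mulmxA Ew mulmx0.
by rewrite mx_kerE => /eqP Ev ->; rewrite mulmxA -SE -mulmxA Ev mulmx0.
Qed.

(** On the kernel of E the adjoint E' is the identity, hence
<x, y> = <x, E'y> = <Ex, y> = 0. *)
Lemma ker_isotropic g (E E' : 'M[int]_(g + g)) :
  E + E' = 1%:M -> adjoint (Jmx g) E E' ->
  isotropic (mx_ker E).
Proof.
move=> EE' adjE x y; rewrite !mx_kerE => /eqP Ex /eqP Ey.
have E'y : E' *m y = y by rewrite -[RHS]mul1mx -EE' mulmxDl Ey add0r.
rewrite -[y in LHS]E'y -[LHS](adjointP x y adjE) Ex.
by rewrite /form trmx0 !mul0mx mxE.
Qed.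

Theorem corollary2 (g : nat) (S : 'M[int]_(g + g))
  (S_Sp : S \in Sp g) (S_inv : S *m S = 1%:M) :
  exists L1 L2 : {pred 'cV[int]_(g + g)},
    [/\ GRing.submod_closed L1 /\ GRing.submod_closed L2,
        is_direct_sum L1 L2,
        isotropic L1 /\ isotropic L2
      & mx_image_eq S L1 /\ mx_image_eq S L2].
Proof.
have S_adj : S^T *m Jmx g = Jmx g *m S.
  case/andP: S_Sp => _ /eqP {2}<-.
  by rewrite -!mulmxA S_inv mulmx1.
have J_skew := Jmx_skew g; have J_unit := Jmx_unit g.
have ortho1 : orthoproj (Jmx g) S 1%:M.
  by split; rewrite /adjoint ?trmx1 ?mulmx1 ?mul1mx.
have [E [E' splitE]] := orthoproj_splits J_skew J_unit S_adj S_inv ortho1.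
have SE' := splitting_comm' J_unit S_adj splitE.
case: splitE => [[one _ EE' E'E] [SE adjE]].
exists (mx_ker E'), (mx_ker E); split.
- by split; apply: ker_submod.
- split=> [w | w]; last first.
    rewrite !mx_kerE => /eqP E'w /eqP Ew.
    by rewrite -[w]mul1mx one mulmxDl Ew E'w addr0.
  exists (E *m w), (E' *m w); rewrite !mx_kerE !mulmxA EE' E'E !mul0mx !eqxx.
  by split=> //; rewrite -mulmxDl -one mul1mx.
- split; last exact: ker_isotropic (esym one) adjE.
  by apply: (ker_isotropic (E' := E)); rewrite 1?addrC //; apply: adjoint_sym.
- by split; apply: ker_image_eq.
Qed.
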